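(* There exists a universal constant $\delta>0$, independent of $n$, such that $$\mathcal{P}\bigl(\Phi_{*}(G_{n,\sigma})>\delta\bigr)=1-o(1)\qquad\text{as } n\to\infty,$$ where $\mathcal{P}$ is the uniform probability measure on permutations $\sigma\in S_{[-n,n]}$ and $\Phi_*(G_{n,\sigma})$ is the bottleneck ratio of the simple random walk on the digraph $G_{n,\sigma}$.
   Context: For a positive integer $n$, $[-n,n]$ denotes the set of integers $\{-n,-n+1,\ldots,n\}$ and $S_{[-n,n]}$ the set of its permutations. For $\sigma\in S_{[-n,n]}$, $G_{n,\sigma}$ is the directed graph with vertex set $[-n,n]$ and edges $(x,\sigma(x-1))$ and $(x,\sigma(x+1))$ for $x\in[-n,n]\setminus\{-n,n\}$, together with the edges $(-n,\sigma(-n))$, $(-n,\sigma(-n+1))$, $(n,\sigma(n-1))$, $(n,\sigma(n))$; here $(a,b)$ is the directed edge from $a$ to $b$ (self-loops may occur). Every vertex has indegree and outdegree $2$, so the uniform distribution is stationary for the simple random walk on $G_{n,\sigma}$. For a nonempty set $S\subset[-n,n]$, the bottleneck ratio is $\Phi(S)=\frac{E(S,S^c)}{2|S|}$, where $E(S,S^c)$ is the number of edges of $G_{n,\sigma}$ going from $S$ to $S^c=[-n,n]\setminus S$, and $\Phi_*(G_{n,\sigma})=\min\{\Phi(S): S\subset[-n,n],\ S\ne\emptyset,\ |S|\le (2n+1)/2\}$. *)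

(* Defs.v *)
From HB Require Import structures.
From mathcomp Require Import all_boot all_order all_fingroup all_algebra.
Set Implicit Arguments.
Unset Strict Implicit.
Unset Printing Implicit Defensive.
Import Order.TTheory GRing.Theory Num.Theory.
Local Open Scope ring_scope.

(* The vertex set [-n, n], the ordinal i standing for the integer i - n. *)
Definition vertex (n : nat) : finType := 'I_(n.*2.+1).

Definition pos (n : nat) (x : vertex n) : int := (x : nat)%:Z - n%:Z.

(* [step x z]: z is one of the two places whose image under sigma is the head
   of an edge out of x. *)
Definition step (n : nat) (x z : vertex n) : bool :=
  if pos x == - n%:Z then (pos z == - n%:Z) || (pos z == - n%:Z + 1)
  else if pos x == n%:Z then (pos z == n%:Z - 1) || (pos z == n%:Z)
  else (pos z == pos x - 1) || (pos z == pos x + 1).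

(* For 0 < n the two places allowed by [step x] are distinct and sigma is
   injective, so G_{n,sigma} has no multiple edges and a set of pairs loses no
   multiplicity. *)
Definition edges (n : nat) (sigma : {perm vertex n}) :
    {set vertex n * vertex n} :=
  [set e | [exists z, step e.1 z && (e.2 == sigma z)]].

Definition edges_between (n : nat) (sigma : {perm vertex n})
    (A B : {set vertex n}) : nat :=
  #|edges sigma :&: setX A B|.

Definition Phi (R : realFieldType) (n : nat) (sigma : {perm vertex n})
    (S : {set vertex n}) : R :=
  (edges_between sigma S (~: S))%:R / (2 * #|S|%:R).

Definition admissible (R : realFieldType) (n : nat) (S : {set vertex n}) :
    bool :=
  (S != set0) && (#|S|%:R <= (2 * n + 1)%:R / 2 :> R).

(* The default value of the iterated minimum is itself attained at an
   admissible set when 0 < n, so this is the minimum (lemma [Phi_starP]);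
   n = 0 has no admissible set. *)
Definition Phi_star (R : realFieldType) (n : nat) (sigma : {perm vertex n}) :
    R :=
  \big[Num.min/Phi R sigma [set ord0]]_(S : {set vertex n} | admissible R S)
    Phi R sigma S.

Lemma admissible1 (R : realFieldType) (n : nat) (x : vertex n) :
  (0 < n)%N -> admissible R [set x].
Proof.
move=> n_gt0; apply/andP; split; first by apply/set0Pn; exists x; rewrite inE.
rewrite cards1 ler_pdivlMr ?ltr0n // mul1r ler_nat.
by case: n n_gt0 {x} => // n _; rewrite mulnS -addnA leq_addr.
Qed.

Lemma Phi_starP (R : realFieldType) (n : nat) (sigma : {perm vertex n}) :
  (0 < n)%N ->
  (exists2 S : {set vertex n},
     admissible R S & Phi_star R sigma = Phi R sigma S) /\
  (forall S : {set vertex n},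
     admissible R S -> Phi_star R sigma <= Phi R sigma S).
Proof.
move=> n_gt0; split; last by move=> S adS; exact: bigmin_le_cond.
apply: (big_ind (fun r => exists2 S, admissible R S & r = Phi R sigma S)).
- by exists [set ord0] => //; exact: admissible1.
- move=> a b [A adA ->] [B adB ->]; rewrite /Num.min /Order.min.
  by case: ifP => _; [exists A | exists B].
- by move=> S adS; exists S.
Qed.

(* Probability of P under the uniform measure on the permutations. *)
Definition perm_prob (R : realFieldType) (n : nat)
    (P : pred {perm vertex n}) : R :=
  #|[set sigma | P sigma]|%:R / #|{perm vertex n}|%:R.

(* Main.v *)
Require Import Defs.
From HB Require Import structures.
From mathcomp Require Import all_boot all_order all_fingroup all_algebra.
From mathcomp Require Import all_classical all_reals all_analysis.
From mathcomp Require Import zify.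
Set Implicit Arguments.
Unset Strict Implicit.
Unset Printing Implicit Defensive.
Import Order.TTheory GRing.Theory Num.Theory.
Import numFieldNormedType.Exports.

(** A uniform permutation is an expander with probability at least
    [1 - 1 / (2n + 1)], for the constant [1 / 120].  The proof is a union bound
    over the sets [S] together with their preimages [T].

    Put [m = 2n + 1], let [S] have [s <= n] elements and let [T] be its
    preimage under sigma.  The edges leaving [S] are the arcs [(x, z)] of the
    looped path (the relation [step]) with [x] in [S] and [z] outside [T].  As
    every vertex of the looped path has two neighbours and [S], [T] have the
    same size, the arcs from the complement of [S] into [T] are equally many,
    so the arcs [(x, z)] for which membership of [x] in [S] and of [z] in [T]
    differ number twice the edges leaving [S] ([edges_between_cut]).

    This set of arcs, [cut_arcs S T], is a complete code for the pair [(S, T)]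
    up to one bit ([cut_arcs_inj]): the bipartite double cover of the looped
    path is a single cycle on its [2m] arcs, so knowing where the indicator of
    the disjoint union of [S] and [T] changes along the cycle determines it up
    to complement.  Hence few pairs have a small cut: if the cut has at most
    [k = s / 30] arcs, there are at most [2 * 'C(3m, k)] pairs, and none when
    [k = 0], since a nontrivial cut is nonempty ([leq_card_thin]).

    On the other hand sigma maps a given [T] onto a given [S] with probability
    at most [1 / 'C(m, s)] ([leq_card_perm_imset]).  The choice of 30 makes
    [m ^ 2 * 'C(3m, k) <= 'C(m, s)] ([leq_sqr_mul_bin]), so each of the [n]
    possible sizes contributes at most [2 / m ^ 2] to the probability that some
    set has a small bottleneck ratio. *)

(** * Binomial estimates *)

Lemma expn_prod n k : n ^ k = \prod_(i < k) n.
Proof. by rewrite prod_nat_const card_ord. Qed.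

(** Factor by factor: [n / k <= (n - i) / (k - i)] for [i < k <= n]. *)
Lemma leq_expn_mul_bin n k : k <= n -> n ^ k <= k ^ k * 'C(n, k).
Proof.
move=> le_kn; rewrite -(leq_pmul2r (fact_gt0 k)) -mulnA bin_ffact -ffactnn.
rewrite !ffact_prod !expn_prod -!big_split /=; apply: leq_prod => i _.
by rewrite !mulnBr (mulnC k n) leq_sub2l // leq_mul2r le_kn orbT.
Qed.

Lemma leq_bin_expn2 n k : 'C(n, k) <= 2 ^ n.
Proof.
elim: n k => [|n IHn] [|k] //; first by rewrite bin0 expn_gt0.
by rewrite binS expnS mul2n -addnn leq_add.
Qed.

(** A form of ['C(n, k) <= (e n / k) ^ k] with [4] for [e], which spares the
    exponential: [k ^ k] is at most the falling factorial of [2 k] with [k]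
    terms, that is ['C(2 k, k) * k`!], and ['C(2 k, k) <= 4 ^ k]. *)
Lemma leq_bin_mul_expn n k : 'C(n, k) * k ^ k <= (4 * n) ^ k.
Proof.
have k_k : k ^ k <= 4 ^ k * k`!.
  apply: (@leq_trans ((2 * k) ^_ k)).
    rewrite ffact_prod expn_prod.
    by apply: leq_prod => i _; have := ltn_ord i; lia.
  by rewrite -bin_ffact leq_mul2r -[4]/(2 ^ 2) -expnM leq_bin_expn2 orbT.
apply: leq_trans (leq_mul (leqnn _) k_k) _.
rewrite mulnCA bin_ffact expnMn leq_mul2l; apply/orP; right.
rewrite ffact_prod expn_prod.
by apply: leq_prod => i _; rewrite leq_subr.
Qed.

Lemma leq_bin_half n i j : i <= j -> j.*2 <= n.+1 -> 'C(n, i) <= 'C(n, j).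
Proof.
elim: j => [|j IHj]; first by rewrite leqn0 => /eqP->.
rewrite leq_eqVlt => /predU1P[-> //|le_ij] le_jn.
apply: leq_trans (IHj le_ij _) _; first by lia.
rewrite -(leq_pmul2l (ltn0Sn j)) mul_bin_left leq_mul2r; apply/orP; right; lia.
Qed.

Lemma leq_mul_bin m n i j : 'C(m, i) * 'C(n, j) <= 'C(m + n, i + j).
Proof.
have lt_i : i < (i + j).+1 by rewrite ltnS leq_addr.
by rewrite -binomial.Vandermonde (bigD1 (Ordinal lt_i)) //= addKn leq_addr.
Qed.

Lemma leq_sum_bin n k : \sum_(j < k.+1) 'C(n, j) <= 'C(n + k, k).
Proof.
rewrite -binomial.Vandermonde; apply: leq_sum => j _.
by rewrite leq_pmulr // bin_gt0 leq_subr.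
Qed.

(** The entropy comparison: taking ten times as many elements outweighs a
    ground set nine times larger.  After the bounds ['C(9m, l) <= (36m / l) ^ l]
    and ['C(m, 10l) >= (m / 10l) ^ (10l)] it remains to see that
    [36m / l <= (m / 10l) ^ 10]; as [m / 10l >= 2], this follows from
    [360 <= 2 ^ 9]. *)
Lemma leq_bin_stretch m l : 20 * l <= m -> 'C(9 * m, l) <= 'C(m, 10 * l).
Proof.
have [->|l_gt0] := posnP l; first by rewrite !bin0.
move=> le_lm; have ll_gt0 a : 0 < (a.+1 * l) ^ (10 * l).
  by rewrite expn_gt0 muln_gt0 l_gt0.
have l_l : 0 < l ^ l by rewrite expn_gt0 l_gt0.
have le_sm : 10 * l <= m by lia.
rewrite -(leq_pmul2r l_l) -(leq_pmul2l (ll_gt0 9)) [leqRHS]mulnA.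
have le1 := leq_mul (leq_expn_mul_bin le_sm) (leqnn (l ^ l)).
apply: leq_trans le1.
have le2 := leq_mul (leqnn ((10 * l) ^ (10 * l))) (leq_bin_mul_expn (9 * m) l).
apply: leq_trans le2 _.
rewrite !expnM -!expnMn leq_exp2r // (expnS m) (expnS (10 * l)).
have le3 : (20 * l) ^ 9 <= m ^ 9 by rewrite leq_exp2r.
apply: (@leq_trans (m * (20 * l) ^ 9 * l)); last first.
  by rewrite leq_mul2r leq_mul2l le3 !orbT.
rewrite -[20]/(2 * 10) -[2 * 10 * l]mulnA (expnMn 2).
set x := (10 * l) ^ 9; rewrite -[2 ^ 9]/(512); nia.
Qed.

(** The two factors [m] are absorbed by ['C(3m, k) >= m], so that the left-hand
    side is at most the cube of ['C(3m, k)], hence at most ['C(9m, 3k)]. *)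
Lemma leq_sqr_mul_bin m k s :
  0 < k -> 30 * k <= s -> s.*2 <= m -> m ^ 2 * 'C(3 * m, k) <= 'C(m, s).
Proof.
move=> k_gt0 le_ks le_sm.
have le_mC : m <= 'C(3 * m, k).
  apply: (@leq_trans 'C(3 * m, 1)); first by rewrite bin1; lia.
  by apply: leq_bin_half; lia.
apply: (@leq_trans ('C(3 * m, k) ^ 2 * 'C(3 * m, k))).
  by rewrite leq_mul2r leq_sqr le_mC orbT.
apply: (@leq_trans 'C(9 * m, 3 * k)).
  have -> : 9 * m = 3 * m + 3 * m + 3 * m by lia.
  have -> : 3 * k = k + k + k by lia.
  apply: leq_trans (leq_mul_bin _ _ _ _).
  by rewrite leq_mul2r -mulnn leq_mul_bin orbT.
apply: (@leq_trans 'C(m, 10 * (3 * k))); first by apply: leq_bin_stretch; lia.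
by apply: leq_bin_half; lia.
Qed.

(** * Permutations mapping one set onto another *)

Lemma perm_maps_set (T : finType) (A B : {set T}) :
  #|A| = #|B| -> exists s : {perm T}, s @: A = B.
Proof.
(* The permutation matches the lists e A and e B of all points position by
   position; the members of A and of B come first in them. *)
move=> eqAB; pose e (C : {set T}) := enum C ++ enum (~: C).
have sz_e C : size (e C) = #|T| by rewrite size_cat -!cardE cardsC.
have mem_e C x : x \in e C by rewrite mem_cat !mem_enum inE orbN.
have uniq_e C : uniq (e C).
  rewrite cat_uniq !enum_uniq andbT; apply/hasPn => x.
  by rewrite /= !mem_enum inE.
pose f x := nth x (e B) (index x (e A)).
have f_inj : injective f.
  move=> x y; rewrite /f (set_nth_default x y) ?sz_e -?(sz_e A) ?index_mem //.
  move/eqP; rewrite nth_uniq ?uniq_e ?sz_e -?(sz_e A) ?index_mem //.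
  by move/eqP=> eq_i; rewrite -(nth_index x (mem_e A x)) eq_i nth_index.
exists (perm f_inj); apply/eqP; rewrite eqEcard card_imset ?eqAB ?leqnn //.
  rewrite andbT; apply/fintype.subsetP=> _ /imsetP[x Ax ->]; rewrite permE /f.
  have lt_x : index x (enum A) < #|A| by rewrite cardE index_mem mem_enum.
  rewrite /e index_cat mem_enum Ax nth_cat -cardE -eqAB lt_x.
  by rewrite -mem_enum mem_nth // -cardE -eqAB.
exact: perm_inj.
Qed.

(** All sets [C] of the size of [B] are equally likely images of [A]: composing
    with a fixed permutation carrying [B] onto [C] turns the permutations with
    [s @: A = B] into permutations with [s @: A = C], and these classes are
    disjoint for distinct [C]. *)
Lemma leq_card_perm_imset (T : finType) (A B : {set T}) :
  #|[set s : {perm T} | s @: A == B]| * 'C(#|T|, #|B|) <= #|{perm T}|.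
Proof.
rewrite -finset.cardsT -cards_draws -cardsX.
pose E := [set C : {set T} | C \subset [set: T] & #|C| == #|B|].
have tau_ex C : exists t : {perm T}, (C \in E) ==> (t @: B == C).
  case: (boolP (C \in E)) => [|_]; last by exists 1%g.
  rewrite inE => /andP[_ /eqP/esym/perm_maps_set[t tB]].
  by exists t; rewrite tB eqxx implybT.
pose tau C := xchoose (tau_ex C).
have tauP C : C \in E -> tau C @: B = C.
  by move=> EC; have /implyP/(_ EC)/eqP := xchooseP (tau_ex C).
pose h (p : {perm T} * {set T}) := (p.1 * tau p.2)%g.
have h_img p : p \in finset.setX [set s : {perm T} | s @: A == B] E ->
    h p @: A = p.2.
  case: p => s C /finset.setXP[/=]; rewrite inE => /eqP sA /tauP tC.
  by rewrite -{2}tC -sA -imset_comp; apply: eq_imset => x; rewrite permM.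
rewrite -(card_in_imset (f := h)) ?max_card //.
move=> p q Dp Dq eq_h; have eq2 : p.2 = q.2 by rewrite -!h_img // eq_h.
move: eq_h; rewrite /h eq2 => /mulIg eq1.
by move: eq1 eq2; case: p {Dp} => ? ?; case: q {Dq} => ? ? /= -> ->.
Qed.

(** * Arcs of the looped path and their cuts *)

(** Truncated predecessor and capped successor account for the two loops, so
    that no case distinction on the ends is left. *)
Lemma stepE n (x z : vertex n) : 0 < n ->
  step x z = (z == x.-1 :> nat) || (z == minn x.+1 n.*2 :> nat).
Proof.
move=> n_gt0; have := ltn_ord x; have := ltn_ord z; rewrite /step /pos.
move: (nat_of_ord x) (nat_of_ord z) => a b.
by case: ifP; last case: ifP; lia.
Qed.

Lemma step_sym n (x z : vertex n) : 0 < n -> step x z = step z x.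
Proof.
move=> n_gt0; rewrite !stepE //; have := ltn_ord x; have := ltn_ord z.
move: (nat_of_ord x) (nat_of_ord z) => a b; lia.
Qed.

Lemma card_step n (x : vertex n) : 0 < n -> #|[set z | step x z]| = 2.
Proof.
move=> n_gt0; have ltx := ltn_ord x.
have lo_lt : x.-1 < n.*2.+1 by lia.
have hi_lt : minn x.+1 n.*2 < n.*2.+1 by lia.
have -> : [set z | step x z] = [set Ordinal lo_lt; Ordinal hi_lt].
  by apply/finset.setP => z; rewrite !inE stepE // -!val_eqE.
by rewrite cards2 -val_eqE /=; case: eqP => //; lia.
Qed.

Definition arcs n : {set vertex n * vertex n} := [set p | step p.1 p.2].

Lemma card_arcs_from n (S : {set vertex n}) : 0 < n ->
  #|[set p in arcs n | p.1 \in S]| = 2 * #|S|.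
Proof.
move=> n_gt0; rewrite -sum1dep_card.
rewrite (eq_bigl (fun p => (p.1 \in S) && step p.1 p.2)); last first.
  by move=> p; rewrite inE andbC.
rewrite -(pair_big_dep (mem S) (fun x z => step x z) (fun _ _ => 1)) /=.
rewrite mulnC -sum_nat_const; apply: eq_bigr => x _.
by rewrite sum1dep_card card_step.
Qed.

(** By symmetry of [step], which makes the in-degrees equal the out-degrees. *)
Lemma card_arcs_to n (T : {set vertex n}) : 0 < n ->
  #|[set p in arcs n | p.2 \in T]| = 2 * #|T|.
Proof.
move=> n_gt0; rewrite -card_arcs_from //.
have swap_inj : injective (fun p : vertex n * vertex n => (p.2, p.1)).
  by move=> [x z] [x' z'] /= [-> ->].
rewrite -(card_imset _ swap_inj); congr #|pred_of_set _|.
apply/finset.setP => -[x z]; apply/imsetP/idP => [[[x' z']]|].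
  by rewrite !inE /= => + [-> ->]; rewrite step_sym.
by rewrite !inE /= => Dp; exists (z, x); rewrite // !inE /= step_sym.
Qed.

Lemma card_arcs n : 0 < n -> #|arcs n| = 2 * n.*2.+1.
Proof.
move=> n_gt0; rewrite -[n.*2.+1]card_ord -finset.cardsT -card_arcs_from //.
by congr #|pred_of_set _|; apply/finset.setP => p; rewrite !inE andbT.
Qed.

Definition cut_arcs n (S T : {set vertex n}) : {set vertex n * vertex n} :=
  [set p in arcs n | (p.1 \in S) != (p.2 \in T)].

(** Each arc [p] satisfies, for the Boolean values [a] of [p.1 \in S] and [b] of
    [p.2 \in T], the identity [(a != b) + a = 2 (a && ~~ b) + b]; summed over
    all arcs, the terms [a] and [b] cancel because both give [2 #|S|]. *)
Lemma card_cut_arcs n (S T : {set vertex n}) : 0 < n -> #|S| = #|T| ->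
  #|cut_arcs S T| = 2 * #|[set p in arcs n | (p.1 \in S) && (p.2 \notin T)]|.
Proof.
move=> n_gt0 eqST; have := card_arcs_from S n_gt0.
rewrite eqST -(card_arcs_to T) //.
have cardE P : #|[set p in arcs n | P p]| = \sum_(p in arcs n) P p.
  by rewrite -sum1dep_card big_mkcondr /=; apply: eq_bigr => p _; case: (P p).
rewrite /cut_arcs !cardE => eq_fromto.
apply/eqP; rewrite -(eqn_add2r (\sum_(p in arcs n) (p.1 \in S))).
rewrite {2}eq_fromto big_distrr -!big_split /=; apply/eqP/eq_bigr => p _.
by case: (p.1 \in S) (p.2 \in T) => [] [].
Qed.

Lemma edges_between_cut n (sigma : {perm vertex n}) (S : {set vertex n}) :
    0 < n ->
  #|cut_arcs S (sigma @^-1: S)| = 2 * edges_between sigma S (~: S).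
Proof.
move=> n_gt0; rewrite card_cut_arcs //; last first.
  rewrite -[in RHS](card_imset _ (@perm_inj _ sigma)).
  congr #|pred_of_set _|; apply/finset.setP => x; apply/idP/imsetP => [Sx|].
    by exists (sigma^-1 x)%g; rewrite ?inE permKV.
  by case=> z; rewrite inE => Sz ->.
congr (2 * _); rewrite /edges_between.
have f_inj : injective (fun p : vertex n * vertex n => (p.1, sigma p.2)).
  by move=> [x z] [x' z'] [-> /perm_inj->].
rewrite -(card_imset _ f_inj); congr #|pred_of_set _|.
apply/finset.setP => -[x y]; apply/imsetP/idP => [[[x' z]]|].
  rewrite !inE /= => /and3P[xz Sx Sz] [-> ->]; rewrite Sx Sz !andbT.
  by apply/existsP; exists z; rewrite xz eqxx.
rewrite !inE /= => /and3P[/existsP[z /andP[xz /eqP->]] Sx Sz].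
by exists (x, z); rewrite // !inE /= xz Sx Sz.
Qed.

(** The double cover of the looped path is connected: starting from the value at
    [ord0] on the [S] side, the loop gives the value at [ord0] on the [T] side,
    and the arcs between [i] and [i + 1] propagate both values along the
    path. *)
Lemma cut_arcs_inj n (S T S' T' : {set vertex n}) : 0 < n ->
    (ord0 \in S) = (ord0 \in S') -> cut_arcs S T = cut_arcs S' T' ->
  S = S' /\ T = T'.
Proof.
move=> n_gt0 eq0 eqC.
have arcP x z : step x z ->
    ((x \in S) == (x \in S')) = ((z \in T) == (z \in T')).
  move=> xz; have /finset.setP/(_ (x, z)) := eqC; rewrite !inE /= xz /=.
  by case: (x \in S) (x \in S') (z \in T) (z \in T') => [] [] [] [].
have agree (x : vertex n) :
    ((x \in S) == (x \in S')) && ((x \in T) == (x \in T')).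
  case: x => i; elim: i => [|i IHi] lt_i.
    have -> : Ordinal lt_i = ord0 by apply: val_inj.
    by rewrite -(arcP ord0) ?eq0 ?eqxx // stepE.
  have lt_i' : i < n.*2.+1 by exact: ltnW.
  have up : step (Ordinal lt_i') (Ordinal lt_i).
    by rewrite stepE //=; apply/orP; right; apply/eqP; lia.
  have /andP[eqS eqT] := IHi lt_i'.
  by rewrite -(arcP _ _ up) eqS andbT (arcP _ (Ordinal lt_i')) // step_sym.
by split; apply/finset.setP => x; have /andP[/eqP ? /eqP ?] := agree x.
Qed.

(** The pairs [(set0, set0)] and [(setT, setT)] have an empty cut, and one of
    them agrees with [(S, T)] at [ord0]. *)
Lemma cut_arcs_neq0 n (S T : {set vertex n}) : 0 < n ->
  S != finset.set0 -> S != finset.setT -> cut_arcs S T != finset.set0.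
Proof.
move=> n_gt0 S0 S1; apply/eqP => C0.
have C_ (A : {set vertex n}) :
    A = finset.set0 \/ A = finset.setT -> cut_arcs A A = finset.set0.
  by case=> ->; apply/finset.setP => p; rewrite !inE andbF.
have [S_0|S_0] := boolP (ord0 \in S).
  have [||/eqP] := @cut_arcs_inj n S T finset.setT finset.setT n_gt0;
    rewrite ?inE //.
    by rewrite C0 C_ //; right.
  by rewrite (negPf S1).
have [||/eqP] := @cut_arcs_inj n S T finset.set0 finset.set0 n_gt0;
  rewrite ?inE ?(negPf S_0) //.
  by rewrite C0 C_ //; left.
by rewrite (negPf S0).
Qed.

(** * Counting pairs with a small cut *)

Lemma leq_card_cover (T I : finType) (A : {set T}) (P : pred I)
    (F : I -> {set T}) :
    (forall x, x \in A -> exists2 i, P i & x \in F i) ->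
  #|A| <= \sum_(i | P i) #|F i|.
Proof.
move=> covA; pose c x := \sum_(i | P i) (x \in F i : nat).
have -> : \sum_(i | P i) #|F i| = \sum_x c x.
  rewrite exchange_big; apply: eq_bigr => i _.
  by rewrite -sum1_card big_mkcond; apply: eq_bigr => x _; case: (x \in F i).
rewrite -sum1_card big_mkcond; apply: leq_sum => x _.
case: ifP => // /covA[i Pi Fix].
by rewrite /c (bigD1 i) //= Fix leq_addr.
Qed.

Lemma leq_card_small_subsets (T : finType) (B : {set T}) k :
  #|[set A : {set T} | A \subset B & #|A| <= k]| <= 'C(#|B| + k, k).
Proof.
apply: leq_trans (leq_sum_bin _ _).
pose F (j : 'I_k.+1) := [set A : {set T} | A \subset B & #|A| == j].
rewrite (eq_bigr (fun j => #|F j|)) => [|j _]; last by rewrite cards_draws.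
apply: leq_card_cover => A; rewrite inE => /andP[sAB]; rewrite -ltnS => ltAk.
by exists (Ordinal ltAk); rewrite // inE sAB eqxx.
Qed.

Definition thin n s : {set {set vertex n} * {set vertex n}} :=
  [set P : {set vertex n} * {set vertex n} |
    [&& #|P.1| == s, #|P.2| == s & 30 * #|cut_arcs P.1 P.2| <= s]].

(** The pair is coded by its cut, a small set of arcs, and one bit. *)
Lemma leq_card_thin_bin n s : 0 < n ->
  #|thin n s| <= 2 * 'C(2 * n.*2.+1 + s %/ 30, s %/ 30).
Proof.
move=> n_gt0; set k := s %/ 30.
pose D := [set A : {set vertex n * vertex n} | A \subset arcs n & #|A| <= k].
pose code (P : {set vertex n} * {set vertex n}) :=
  (ord0 \in P.1, cut_arcs P.1 P.2).
have code_inj : injective code.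
  by move=> [S T] [S' T'] [/= e0 eC]; have [-> ->] := cut_arcs_inj n_gt0 e0 eC.
rewrite -(card_imset _ code_inj) -(card_arcs n_gt0).
apply: (@leq_trans #|finset.setX [set: bool] D|).
  apply/subset_leq_card/fintype.subsetP => _ /imsetP[[S T] + ->].
  rewrite !inE /= => /and3P[_ _ thinP]; apply/andP; split.
    by apply/fintype.subsetP => p; rewrite inE => /andP[].
  by rewrite leq_divRL // mulnC.
by rewrite cardsX finset.cardsT card_bool leq_mul2l leq_card_small_subsets.
Qed.

(** For [s < 30] the condition in [thin] forces an empty cut, which is impossible
    since a set with [0 < s <= n] elements is neither empty nor full; otherwise
    [s %/ 30 > 0] and the binomial estimate applies. *)
Lemma leq_card_thin n s : 0 < s <= n ->
  n.*2.+1 ^ 2 * #|thin n s| <= 2 * 'C(n.*2.+1, s).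
Proof.
move=> /andP[s_gt0 le_sn]; have n_gt0 : 0 < n by apply: leq_trans le_sn.
have [k0|k_gt0] := posnP (s %/ 30).
  suff -> : #|thin n s| = 0 by rewrite muln0.
  apply/eqP; rewrite cards_eq0; apply/eqP/finset.setP => -[S T]; rewrite !inE.
  apply/negP => /and3P[/= /eqP cS _ thinST].
  have: cut_arcs S T != finset.set0.
    apply: cut_arcs_neq0 => //; first by rewrite -cards_eq0 cS -lt0n.
    by apply/eqP => S1; move: cS; rewrite S1 finset.cardsT card_ord; lia.
  by rewrite -card_gt0; move: thinST; move: #|cut_arcs S T| => c; lia.
apply: leq_trans (leq_mul (leqnn _) (leq_card_thin_bin s n_gt0)) _.
rewrite mulnCA leq_mul2l /=.
have le_ks : 30 * (s %/ 30) <= s by rewrite mulnC leq_divM.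
apply: (@leq_trans (n.*2.+1 ^ 2 * 'C(3 * n.*2.+1, s %/ 30))).
  by rewrite leq_mul2l; apply/orP; right; apply: leq_bin2l; lia.
by apply: leq_sqr_mul_bin => //; lia.
Qed.

(** * The union bound *)

(** The factor 60 is twice the 30 of [thin], since a cut has twice as many arcs
    as there are edges leaving the set; a ratio of edges to [2 s] of at most
    [1 / 120] is this same condition. *)
Definition bottleneck n s : {set {perm vertex n}} :=
  [set sigma | [exists S : {set vertex n}, (#|S| == s) &&
                  (60 * edges_between sigma S (~: S) <= s)]].

Lemma leq_card_bottleneck n s : 0 < s <= n ->
  n.*2.+1 ^ 2 * #|bottleneck n s| <= 2 * #|{perm vertex n}|.
Proof.
move=> sn; have /andP[s_gt0 le_sn] := sn.
have n_gt0 : 0 < n by apply: leq_trans le_sn.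
pose F (P : {set vertex n} * {set vertex n}) :=
  [set sigma : {perm vertex n} | sigma @: P.2 == P.1].
have cov : #|bottleneck n s| <= \sum_(P in thin n s) #|F P|.
  apply: leq_card_cover => sigma; rewrite inE.
  case/existsP => S /andP[/eqP cS leE].
  have imS : sigma @: (sigma @^-1: S) = S.
    apply/finset.setP => x; apply/imsetP/idP => [[z]|Sx].
      by rewrite inE => Sz ->.
    by exists (sigma^-1 x)%g; rewrite ?inE permKV.
  exists (S, sigma @^-1: S); last by rewrite inE /= imS.
  rewrite inE /= edges_between_cut // cS eqxx.
  by rewrite -(card_imset _ (@perm_inj _ sigma)) imS cS eqxx /=; lia.
have C_gt0 : 0 < 'C(n.*2.+1, s) by rewrite bin_gt0; lia.
rewrite -(leq_pmul2r C_gt0) -mulnA.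
have le_sum : #|bottleneck n s| * 'C(n.*2.+1, s) <=
    #|thin n s| * #|{perm vertex n}|.
  apply: leq_trans (leq_mul cov (leqnn _)) _.
  rewrite big_distrl -sum_nat_const; apply: leq_sum => -[S T].
  rewrite inE => /and3P[/= /eqP cS _ _].
  by have := leq_card_perm_imset T S; rewrite cS card_ord.
apply: leq_trans (leq_mul (leqnn _) le_sum) _.
by rewrite mulnA (mulnAC 2) leq_mul2r leq_card_thin // orbT.
Qed.

Lemma Phi_star_bottleneck (R : realFieldType) n (sigma : {perm vertex n}) :
    0 < n -> ~~ (120^-1 < Phi_star R sigma)%R ->
  exists2 s : 'I_n, true & sigma \in bottleneck n s.+1.
Proof.
move=> n_gt0; rewrite -leNgt => le_Phi.
have [[S /andP[S0 leS] eqPhi] _] := Phi_starP R sigma n_gt0.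
have S_gt0 : 0 < #|S| by rewrite card_gt0.
have leSn : #|S| <= n.
  move: leS; rewrite ler_pdivlMr ?ltr0n // -natrM ler_nat; lia.
have ltS : #|S|.-1 < n by rewrite prednK.
exists (Ordinal ltS) => //; rewrite inE /= prednK //.
apply/existsP; exists S; rewrite eqxx /=.
move: le_Phi; rewrite eqPhi /Phi ler_pdivrMr; last first.
  by rewrite -natrM ltr0n muln_gt0.
rewrite -(ler_pM2l (_ : 0 < 120)%R) ?ltr0n // mulrA divff ?pnatr_eq0 // mul1r.
by rewrite -!natrM ler_nat; move: #|S| (edges_between _ _ _) => a b; lia.
Qed.

(** There are [n] sizes, each of which costs a proportion of [2 / m ^ 2] for
    [m = 2n + 1], and [2 n <= m]. *)
Lemma leq_card_not_expander (R : realFieldType) n : 0 < n ->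
  n.*2.+1 * #|[set sigma : {perm vertex n} | ~~ (120^-1 < Phi_star R sigma)%R]|
    <= #|{perm vertex n}|.
Proof.
move=> n_gt0; set A := [set sigma | _].
have leA : #|A| <= \sum_(s < n) #|bottleneck n s.+1|.
  by apply: leq_card_cover => sigma; rewrite inE; exact: Phi_star_bottleneck.
have leB : n.*2.+1 ^ 2 * #|A| <= n * (2 * #|{perm vertex n}|).
  apply: leq_trans (leq_mul (leqnn _) leA) _.
  rewrite big_distrr -[n in n * _]card_ord -sum_nat_const.
  by apply: leq_sum => s _; apply: leq_card_bottleneck; rewrite ltn_ord.
rewrite -(leq_pmul2l (ltn0Sn n.*2)) mulnA mulnn; apply: leq_trans leB _.
by rewrite mulnA leq_mul2r; apply/orP; right; lia.
Qed.

Lemma perm_prob_expander (R : realFieldType) n : 0 < n ->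
  (1 - harmonic n <=
   perm_prob R (fun sigma : {perm vertex n} => 120^-1 < Phi_star R sigma) <=
   1)%R.
Proof.
move=> n_gt0; rewrite /perm_prob.
set P := fun sigma : {perm vertex n} => _.
have N_gt0 : 0 < #|{perm vertex n}| by apply/card_gt0P; exists 1%g.
have eqC : #|[set sigma | P sigma]| + #|[set sigma | ~~ P sigma]| =
    #|{perm vertex n}|.
  rewrite -(cardsC [set sigma | P sigma]); congr (_ + #|pred_of_set _|).
  by apply/finset.setP => sigma; rewrite !inE.
have leb : n.*2.+1 * #|[set sigma | ~~ P sigma]| <= #|{perm vertex n}| :=
  leq_card_not_expander R n_gt0.
move: eqC N_gt0 leb; move: #|{perm _}| #|[set sigma | P sigma]|.
move: #|[set sigma | ~~ P sigma]| => b N a eqC N_gt0 leb.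
rewrite ler_pdivlMr ?ler_pdivrMr ?ltr0n // mul1r ler_nat.
rewrite -{2}eqC leq_addr andbT mulrBl mul1r -{1}eqC natrD lerBlDr lerD2l.
rewrite -(ler_pM2l (_ : 0 < n.+1%:R)%R) ?ltr0n // /harmonic /= mulrA.
rewrite divff ?pnatr_eq0 // mul1r -natrM ler_nat.
by apply: leq_trans leb; rewrite leq_mul2r; apply/orP; right; lia.
Qed.

Local Open Scope classical_set_scope.
Local Open Scope ring_scope.

Theorem theorem7 (R : realType) :
  exists delta : R, 0 < delta /\
    perm_prob R (fun sigma : {perm vertex n} => delta < Phi_star R sigma)
      @[n --> \oo] --> (1 : R).
Proof.
exists 120^-1; split; first by rewrite invr_gt0.
apply: (squeeze_cvgr (f := fun n => 1 - harmonic n) (h := fun=> 1)).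
- by near=> n; apply: perm_prob_expander; near: n; exact: nbhs_infty_gt.
- rewrite -[X in _ --> X]subr0; apply: cvgB; first exact: cvg_cst.
  exact: cvg_harmonic.
- exact: cvg_cst.
Unshelve. all: by end_near. Qed.
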